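(* Let $X(t,\theta,\phi)=t\,\vec b+\cos\theta\cos\phi\,\vec a_0(t)+\sin\theta\cos\phi\,\vec a_1(t)+\sin\phi\,\vec a_2(t)$ be a kinematic 3-surface in $\mathbf{E}^7$ foliated by spheres (as defined in the context), with parameters $s',\omega_1,\dots,\omega_{15},b'_4,\dots,b'_7\in\mathbb{R}$. If the scalar curvature of $X$ at the zero position $t=0$ is constant and equal to zero, then $$\omega_1=\omega_2=\omega_7=0,$$ $$\sum_{i=4}^{7}b'_i\,\omega_{i-1}=\sum_{i=4}^{7}b'_i\,\omega_{i+4}=\sum_{i=4}^{7}b'_i\,\omega_{i+8}=0,$$ $$\sum_{i=3}^{6}\omega_i^2=\sum_{i=4}^{7}b_i'^2 .$$
   Context: Kinematic surface. Fix real parameters $s'$, $\omega_1,\dots,\omega_{15}$ and $b'_1,\dots,b'_7$, and put $\vec b=(b'_1,\dots,b'_7)^{T}$, $\vec a_0(t)=(1+s't,-\omega_1t,-\omega_2t,-\omega_3t,-\omega_4t,-\omega_5t,-\omega_6t)^T$, $\vec a_1(t)=(\omega_1t,1+s't,-\omega_7t,-\omega_8t,-\omega_9t,-\omega_{10}t,-\omega_{11}t)^T$, $\vec a_2(t)=(\omega_2t,\omega_7t,1+s't,-\omega_{12}t,-\omega_{13}t,-\omega_{14}t,-\omega_{15}t)^T$. The kinematic 3-surface is the first-order (in $t$) motion of the unit sphere under a one-parameter equiform motion of $\mathbf{E}^7$: $$X(t,\theta,\phi)=t\,\vec b+\cos\theta\cos\phi\,\vec a_0(t)+\sin\theta\cos\phi\,\vec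 a_1(t)+\sin\phi\,\vec a_2(t)\in\mathbf{E}^7 .$$ Here $s'$ is the derivative at $t=0$ of the scaling factor, the $\omega_i$ are entries of the skew-symmetric derivative at $t=0$ of the rotation part, and $\vec b$ is the derivative at $t=0$ of the translation part. Standing assumptions. (1) Each slice $t=\mathrm{const}$ is a round 2-sphere, expressed by $\sum_{i=2}^{6}\omega_i\omega_{i+5}=0$, $\ \omega_1\omega_7-\sum_{i=3}^{6}\omega_i\omega_{i+9}=0$, $\ \omega_1\omega_2+\sum_{i=8}^{11}\omega_i\omega_{i+4}=0$, $\ \sum_{i=2}^{6}\omega_i^2=\sum_{i=7}^{11}\omega_i^2$, $\ \omega_1^2+\sum_{i=3}^{6}\omega_i^2=\omega_7^2+\sum_{i=12}^{15}\omega_i^2$. (2) There is no translation in the 3-space of the starting sphere: $b'_1=b'_2=b'_3=0$. (3) $X$ is an immersion at all points $(0,\theta,\phi)$ with $\cos\phi\neq0$. Scalar curvature. Let $g$ be the metric induced by $X$ from $\mathbf{E}^7$ in the coordinates $(x_1,x_2,x_3)=(t,\theta,\phi)$, with Christoffel symbols $\Gamma_{ij}^l$. Its scalar curvature is $g^{ij}\big[\partial_l\Gamma_{ij}^l-\partial_j\Gamma_{il}^l+\Gamma_{ij}^l\Gamma_{lm}^m-\Gamma_{il}^m\Gamma_{jm}^l\big]$. ''Constant scalar curvature'' means that its value at $(0,\theta,\phi)$ is the same for all $\theta,\phi$ with $\cos\phi\ne0$; the curvature is considered only at $t=0$. *)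

(* Defs.v *)
From HB Require Import structures.
From mathcomp Require Import all_boot all_order all_algebra.
From mathcomp Require Import all_classical all_reals all_analysis.
Set Implicit Arguments.
Unset Strict Implicit.
Unset Printing Implicit Defensive.
Import Order.TTheory GRing.Theory Num.Theory.
Import numFieldNormedType.Exports.
Local Open Scope ring_scope.

Definition dot (R : realType) (n : nat) (u v : 'rV[R]_n) : R :=
  \sum_(k < n) u 0 k * v 0 k.

Definition partial (R : realType) (n : nat) (V : normedModType R)
    (i : 'I_n.+1) (f : 'rV[R]_n.+1 -> V) (x : 'rV[R]_n.+1) : V :=
  'D_(delta_mx 0 i) f x.

Definition immersion_at (R : realType) (n m : nat)
    (X : 'rV[R]_n.+1 -> 'rV[R]_m.+1) (x : 'rV[R]_n.+1) : Prop :=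
  differentiable X x /\ injective ('d X x).

Definition induced_metric (R : realType) (n m : nat)
    (X : 'rV[R]_n.+1 -> 'rV[R]_m.+1) (x : 'rV[R]_n.+1) : 'M[R]_n.+1 :=
  \matrix_(i, j) dot (partial i X x) (partial j X x).

Section Curvature.
Variables (R : realType) (n : nat) (g : 'rV[R]_n.+1 -> 'M[R]_n.+1).

(* Levi-Civita symbols; [christoffel l i j x] is \Gamma_{ij}^l at x. *)
Definition christoffel (l i j : 'I_n.+1) (x : 'rV[R]_n.+1) : R :=
  2^-1 * \sum_m invmx (g x) l m *
    (partial i (fun y => g y j m) x + partial j (fun y => g y i m) x
     - partial m (fun y => g y i j) x).

Definition scalar_curvature (x : 'rV[R]_n.+1) : R :=
  \sum_i \sum_j invmx (g x) i j *
    \sum_l (partial l (christoffel l i j) x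
            - partial j (christoffel l i l) x
            + \sum_m (christoffel l i j x * christoffel m l m x
                      - christoffel m i l x * christoffel l j m x)).

End Curvature.

(* Sequences w and b carry the 1-based indices w_1, ..., w_15, b'_1, ..., b'_7;
   their other values are never used. *)
Section KinematicSurface.
Variables (R : realType) (s : R) (w b : nat -> R).

Definition bvec : 'rV[R]_7 := \row_(k < 7) b k.+1.

Definition a0 (t : R) : 'rV[R]_7 := \row_(k < 7)
  [:: 1 + s * t; - w 1%N * t; - w 2%N * t; - w 3%N * t;
      - w 4%N * t; - w 5%N * t; - w 6%N * t]`_k.

Definition a1 (t : R) : 'rV[R]_7 := \row_(k < 7)
  [:: w 1%N * t; 1 + s * t; - w 7%N * t; - w 8%N * t;
      - w 9%N * t; - w 10%N * t; - w 11%N * t]`_k.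

Definition a2 (t : R) : 'rV[R]_7 := \row_(k < 7)
  [:: w 2%N * t; w 7%N * t; 1 + s * t; - w 12%N * t;
      - w 13%N * t; - w 14%N * t; - w 15%N * t]`_k.

(* The coordinates of x are (t, theta, phi). *)
Definition kinematic_surface (x : 'rV[R]_3) : 'rV[R]_7 :=
  let t := x 0 0 in let theta := x 0 1 in let phi := x 0 2 in
  t *: bvec + (cos theta * cos phi) *: a0 t
  + (sin theta * cos phi) *: a1 t + sin phi *: a2 t.

Definition spherical_slices : Prop :=
  [/\ \sum_(2 <= i < 7) w i * w (i + 5)%N = 0,
      w 1%N * w 7%N - \sum_(3 <= i < 7) w i * w (i + 9)%N = 0,
      w 1%N * w 2%N + \sum_(8 <= i < 12) w i * w (i + 4)%N = 0,
      \sum_(2 <= i < 7) w i ^+ 2 = \sum_(7 <= i < 12) w i ^+ 2 &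
      w 1%N ^+ 2 + \sum_(3 <= i < 7) w i ^+ 2
        = w 7%N ^+ 2 + \sum_(12 <= i < 16) w i ^+ 2].

Definition no_starting_translation : Prop := [/\ b 1%N = 0, b 2%N = 0 & b 3%N = 0].

End KinematicSurface.

Definition point_at_zero (R : realType) (theta phi : R) : 'rV[R]_3 :=
  \row_(k < 3) [:: 0; theta; phi]`_k.

Definition immersed_at_zero (R : realType) (X : 'rV[R]_3 -> 'rV[R]_7) : Prop :=
  forall theta phi : R, cos phi != 0 ->
    immersion_at X (point_at_zero theta phi).

Definition constant_scalar_curvature_at_zero (R : realType)
    (X : 'rV[R]_3 -> 'rV[R]_7) (c : R) : Prop :=
  forall theta phi : R, cos phi != 0 ->
    scalar_curvature (induced_metric X) (point_at_zero theta phi) = c.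

(* Main.v *)
Require Import Defs.
From mathcomp Require Import all_boot all_order all_algebra.
From mathcomp Require Import all_classical all_reals all_analysis.
From mathcomp Require Import ring lra.
Import Order.TTheory GRing.Theory Num.Theory.
Import numFieldNormedType.Exports.
Local Open Scope ring_scope.

(* With n the point (theta, phi) of the unit sphere, X = t b + n + t C n for a
   constant 7 x 3 matrix C.  The slice conditions say C^T C = L I, so in
   coordinates (t, n) the metric is
     (|b|^2 + L + 2 beta.n) dt^2 + 2 (t beta + W n).dn dt + (1 + 2 s t + L t^2) dn^2
   with beta = C^T b and W the skew matrix built from w_1, w_2, w_7.  Let omega be
   the axial vector of W, so that |W n|^2 = |omega|^2 - (omega.n)^2, and let
   Q = det g / cos(phi)^2 at t = 0.  There the scalar curvature times Q^2 is a
   polynomial in n whose part even under n -> -n has the form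
     6 (omega.n)^4 + k (omega.n)^2 + 6 (beta.n)^2 + const.
   If it vanishes on the equator, the fourth harmonic of the quartic term forces
   omega, and then beta, to be orthogonal to the equatorial plane; the surface is
   now axially symmetric, and the meridian theta = 0 yields omega = beta = 0.  What
   is left is 2 Q^2 + (2 s^2 - 4 L) Q = 0 with Q = |b|^2 + L nonzero. *)

(** * Differentiating the inverse of a matrix-valued function *)

Section InverseMatrix.
Set Implicit Arguments.
Unset Strict Implicit.
Context {R : realType} {V : normedModType R}.

Lemma differentiable_bigsum (I : Type) (r : seq I) (P : pred I) (F : I -> V -> R) x :
  (forall i, differentiable (F i) x) ->
  differentiable (fun y => \sum_(i <- r | P i) F i y) x.
Proof.
move=> dF; elim: r => [|i r IH].
  under eq_fun do rewrite big_nil; exact: differentiable_cst.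
under eq_fun do rewrite big_cons.
by case: (P i) => //; apply: differentiableD.
Qed.

Lemma differentiable_bigprod (I : Type) (r : seq I) (P : pred I) (F : I -> V -> R) x :
  (forall i, differentiable (F i) x) ->
  differentiable (fun y => \prod_(i <- r | P i) F i y) x.
Proof.
move=> dF; elim: r => [|i r IH].
  under eq_fun do rewrite big_nil; exact: differentiable_cst.
under eq_fun do rewrite big_cons.
by case: (P i) => //; apply: differentiableM.
Qed.

Lemma differentiable_det n (M : V -> 'M[R]_n) x :
  (forall i j, differentiable (fun y => M y i j) x) ->
  differentiable (fun y => \det (M y)) x.
Proof.
move=> dM; apply: differentiable_bigsum => s.
apply: differentiableM; first exact: differentiable_cst.
exact: differentiable_bigprod.
Qed.

Lemma near_unitmx n (M : V -> 'M[R]_n) x :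
  (forall i j, differentiable (fun y => M y i j) x) ->
  M x \in unitmx -> \forall y \near x, M y \in unitmx.
Proof.
move=> dM uM.
have := differentiable_continuous (differentiable_det dM).
rewrite unitmxE unitfE in uM.
move=> /(_ _ (open_nbhs_nbhs (conj (@open_neq R 0) uM))) dM0.
have {dM0} : \forall y \near x, \det (M y) != 0 by exact: dM0.
by apply: filterS => y; rewrite unitmxE unitfE.
Qed.

(** Cramer's rule: adjugate and determinant are polynomials in the entries. The formula is used only
    near [x], because [invmx] returns its argument on singular matrices. *)
Lemma derivable_invmx n (M : V -> 'M[R]_n) x v i j :
  (forall i j, differentiable (fun y => M y i j) x) ->
  M x \in unitmx -> derivable (fun y => invmx (M y) i j) x v.
Proof.
move=> dM uM.
have E : {near x, (fun y => (\det (M y))^-1 * (\adj (M y)) i j)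
                 =1 (fun y => invmx (M y) i j)}.
  near do rewrite /invmx; near=> y.
  have -> : M y \in unitmx by near: y; exact: near_unitmx.
  by rewrite !mxE.
apply: (near_eq_derivable E); apply/diff_derivable/differentiableM.
  apply: differentiableV; first exact: differentiable_det.
  by rewrite unitmxE unitfE in uM.
under eq_fun do rewrite mxE.
apply: differentiableM; first exact: differentiable_cst.
apply: differentiable_det => k l.
by under eq_fun do rewrite !mxE.
Unshelve. all: by end_near. Qed.

Lemma derive_bigsum (n : nat) (F : 'I_n -> V -> R) x v :
  (forall i, derivable (F i) x v) ->
  'D_v (fun y => \sum_i F i y) x = \sum_i 'D_v (F i) x.
Proof. by move=> dF; rewrite -derive_sum// fct_sumE. Qed.

(** The product of [M] and its inverse is constant near [x]; differentiate it by the Leibniz rule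
    and solve for the derivative of the inverse. *)
Lemma derive_invmx n (M : V -> 'M[R]_n) x v :
  (forall i j, differentiable (fun y => M y i j) x) ->
  M x \in unitmx ->
  \matrix_(i, j) 'D_v (fun y => invmx (M y) i j) x =
  - (invmx (M x) *m \matrix_(i, j) 'D_v (fun y => M y i j) x *m invmx (M x)).
Proof.
move=> dM uM; set dI := LHS; set D := \matrix_(i, j) 'D_v (fun y => M y i j) x.
have dM' i j : derivable (fun y => M y i j) x v by exact/diff_derivable.
have dI' i j : derivable (fun y => invmx (M y) i j) x v by exact: derivable_invmx.
suff E : M x *m dI + D *m invmx (M x) = 0.
  by rewrite -[dI](mulKmx uM) (canRL (addrK _) E) sub0r mulmxN mulmxA.
apply/matrixP => i j; rewrite !mxE -big_split /=.
transitivity ('D_v (fun y => \sum_k M y i k * invmx (M y) k j) x).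
  rewrite derive_bigsum => [|k]; last exact: derivableM.
  apply: eq_bigr => k _; rewrite !mxE.
  rewrite (deriveM (f := fun y => M y i k) (g := fun y => invmx (M y) k j))//.
  by rewrite /GRing.scale /= [X in _ + X]mulrC.
rewrite (@near_eq_derive _ _ _ _ (cst ((1%:M : 'M[R]_n) i j))) ?derive_cst//.
by apply: filterS (near_unitmx dM uM) => y uy; rewrite /= -(mulmxV uy) mxE.
Qed.

End InverseMatrix.

(** * Derivatives of the Christoffel symbols *)

Section DerivedCurvature.
Set Implicit Arguments.
Unset Strict Implicit.
Variables (R : realType) (n : nat) (g : 'rV[R]_n.+1 -> 'M[R]_n.+1).
Variables (G1 : 'I_n.+1 -> 'I_n.+1 -> 'I_n.+1 -> 'rV[R]_n.+1 -> R).
Hypothesis g_diff : forall i j x, differentiable (fun y => g y i j) x.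
Hypothesis gG1 : forall k i j x, partial k (fun y => g y i j) x = G1 k i j x.
Hypothesis G1_diff : forall k i j x, differentiable (G1 k i j) x.

(** Write the symbol as the inverse metric applied to the symbols [B m] of the first kind. The
    derivative of the inverse produces two inverse factors, and the right one recombines with [B]
    into a Christoffel symbol. So no derivative of the inverse remains, only the partials of [g] up
    to order two. *)
Lemma partial_christoffel d l i j x : g x \in unitmx ->
  partial d (christoffel g l i j) x =
  \sum_p invmx (g x) l p *
   (2^-1 * (partial d (G1 i j p) x + partial d (G1 j i p) x - partial d (G1 p i j) x)
    - \sum_q G1 d p q x * christoffel g q i j x).
Proof.
move=> ux.
have -> : christoffel g l i j = fun y =>
    \sum_m invmx (g y) l m * (2^-1 * (G1 i j m y + G1 j i m y - G1 m i j y)).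
  apply/funext => y; rewrite /christoffel big_distrr /=; apply: eq_bigr => m _.
  by rewrite !gG1; ring.
set B := fun m y => 2^-1 * (G1 i j m y + G1 j i m y - G1 m i j y).
have dB m : derivable (B m) x (delta_mx 0 d).
  apply/diff_derivable/differentiableM; first exact: differentiable_cst.
  by apply: differentiableB; first apply: differentiableD.
rewrite /partial derive_bigsum => [|m]; last first.
  apply: (derivableM (f := fun y => invmx (g y) l m) (g := B m)) => [|//].
  by apply: derivable_invmx => // *; exact: g_diff.
transitivity (\sum_m (invmx (g x) l m * 'D_(delta_mx 0 d) (B m) x -
   B m x * \sum_p \sum_q invmx (g x) l p * G1 d p q x * invmx (g x) q m)).
  apply: eq_bigr => m _.
  rewrite (deriveM (f := fun y => invmx (g y) l m) (g := B m))//; last exact: derivable_invmx.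
  rewrite /GRing.scale /=; congr (_ + _); rewrite -mulrN; congr (_ * _).
  have /matrixP/(_ l m) := derive_invmx (delta_mx 0 d) (fun i j => g_diff i j x) ux.
  rewrite !mxE => ->; congr (- _).
  rewrite exchange_big /=; apply: eq_bigr => q _; rewrite !mxE big_distrl /=.
  by apply: eq_bigr => p _; rewrite !mxE -gG1.
have EB m : 'D_(delta_mx 0 d) (B m) x = 2^-1 * (partial d (G1 i j m) x
    + partial d (G1 j i m) x - partial d (G1 m i j) x).
  rewrite deriveMl /partial; last first.
    by apply/diff_derivable/differentiableB; first apply: differentiableD.
  rewrite (deriveB (f := fun y => G1 i j m y + G1 j i m y))//;
    try exact/diff_derivable; last exact/diff_derivable/differentiableD.
  by rewrite deriveD//; exact/diff_derivable.
rewrite sumrB.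
under [in RHS]eq_bigr do rewrite mulrBr -EB.
rewrite sumrB; congr (_ - _).
under eq_bigr do rewrite big_distrr /=.
rewrite exchange_big /=; apply: eq_bigr => p _.
under eq_bigr do rewrite big_distrr /=.
rewrite exchange_big /= big_distrr /=; apply: eq_bigr => q _.
rewrite /christoffel !big_distrr /=; apply: eq_bigr => m _.
rewrite !gG1 /B; ring.
Qed.

End DerivedCurvature.

(** * Invertibility of the metric of an immersion *)

Section Gram.
Set Implicit Arguments.
Unset Strict Implicit.
Variable R : realType.

Lemma dot_suml (n p : nat) (c : 'I_n -> R) (F : 'I_n -> 'rV[R]_p) v :
  dot (\sum_i c i *: F i) v = \sum_i c i * dot (F i) v.
Proof.
rewrite /dot; under eq_bigr do rewrite summxE big_distrl /=.
rewrite exchange_big /=; apply: eq_bigr => i _.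
by rewrite big_distrr; apply: eq_bigr => k _; rewrite mxE /=; ring.
Qed.

Lemma dotC (p : nat) (u v : 'rV[R]_p) : dot u v = dot v u.
Proof. by apply: eq_bigr => k _; rewrite mulrC. Qed.

Lemma dot_eq0 (p : nat) (u : 'rV[R]_p) : dot u u = 0 -> u = 0.
Proof.
move/eqP; rewrite psumr_eq0 => [/allP u0|k _]; last by rewrite -expr2 sqr_ge0.
apply/rowP => k; rewrite mxE; apply/eqP.
by have := u0 k (mem_index_enum _); rewrite mulf_eq0 orbb.
Qed.

(** A null vector v of the Gram matrix makes dX(v) orthogonal to every partial derivative of X,
    hence to itself; so dX(v) = 0, and v = 0 by injectivity. *)
Lemma immersion_metric_unitmx (n m : nat) (X : 'rV[R]_n.+1 -> 'rV[R]_m.+1) x :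
  immersion_at X x -> induced_metric X x \in unitmx.
Proof.
case=> dX injX; rewrite unitmxE unitfE; apply/negP => /det0P[v v0 vg].
have partialE i : partial i X x = 'd X x (delta_mx 0 i) by exact: deriveE.
have dXv : 'd X x v = \sum_i v 0 i *: partial i X x.
  rewrite {1}[v]row_sum_delta linear_sum.
  by apply: eq_bigr => i _; rewrite linearZ partialE.
have dXv0 j : dot ('d X x v) (partial j X x) = 0.
  move/rowP/(_ j): vg; rewrite !mxE => <-; rewrite dXv dot_suml.
  by apply: eq_bigr => i _; rewrite mxE.
move/negP: v0; apply; apply/eqP/injX; rewrite linear0; apply: dot_eq0.
by rewrite {1}dXv dot_suml big1// => i _; rewrite dotC dXv0 mulr0.
Qed.

End Gram.

(** * Symbolic differentiation of trigonometric polynomials *)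

Section TrigonometricPolynomials.
Set Implicit Arguments.
Unset Strict Implicit.
Variable R : realType.

(** A syntax that covers the components of X and the entries of its metric, so that their iterated
    partial derivatives are computed by [tpderiv]. *)
Inductive trigpoly : Type :=
  | TPconst of R
  | TPtime
  | TPcos_theta
  | TPsin_theta
  | TPcos_phi
  | TPsin_phi
  | TPadd of trigpoly & trigpoly
  | TPmul of trigpoly & trigpoly.

Fixpoint tpeval (e : trigpoly) (x : 'rV[R]_3) : R :=
  match e with
  | TPconst a => a
  | TPtime => x 0 0
  | TPcos_theta => cos (x 0 1)
  | TPsin_theta => sin (x 0 1)
  | TPcos_phi => cos (x 0 2)
  | TPsin_phi => sin (x 0 2)
  | TPadd e1 e2 => tpeval e1 x + tpeval e2 x
  | TPmul e1 e2 => tpeval e1 x * tpeval e2 x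
  end.

Fixpoint tpderiv (k : nat) (e : trigpoly) : trigpoly :=
  match e with
  | TPconst a => TPconst 0
  | TPtime => TPconst (k == 0%N)%:R
  | TPcos_theta => if k == 1%N then TPmul (TPconst (-1)) TPsin_theta else TPconst 0
  | TPsin_theta => if k == 1%N then TPcos_theta else TPconst 0
  | TPcos_phi => if k == 2%N then TPmul (TPconst (-1)) TPsin_phi else TPconst 0
  | TPsin_phi => if k == 2%N then TPcos_phi else TPconst 0
  | TPadd e1 e2 => TPadd (tpderiv k e1) (tpderiv k e2)
  | TPmul e1 e2 => TPadd (TPmul (tpderiv k e1) e2) (TPmul e1 (tpderiv k e2))
  end.

Lemma tpeval_differentiable e x : differentiable (tpeval e) x.
Proof.
have dcos (i : 'I_3) : differentiable (fun y : 'rV[R]_3 => cos (y 0 i)) x.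
  apply: (differentiable_comp (f := fun y : 'rV[R]_3 => y 0 i)).
    exact: differentiable_coord.
  exact/derivable1_diffP/derivable_cos.
have dsin (i : 'I_3) : differentiable (fun y : 'rV[R]_3 => sin (y 0 i)) x.
  apply: (differentiable_comp (f := fun y : 'rV[R]_3 => y 0 i)).
    exact: differentiable_coord.
  exact/derivable1_diffP/derivable_sin.
elim: e => [a||||||e1 d1 e2 d2|e1 d1 e2 d2].
- exact: (differentiable_cst a).
- exact: (differentiable_coord _ 0 0).
- exact: (dcos 1).
- exact: (dsin 1).
- exact: (dcos 2).
- exact: (dsin 2).
- exact: (differentiableD d1 d2).
- exact: (differentiableM d1 d2).
Qed.

Lemma derive_coord (v x : 'rV[R]_3) (i : 'I_3) :
  'D_v (fun y : 'rV[R]_3 => y 0 i) x = v 0 i.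
Proof.
by rewrite -[in RHS](derive_id x v) (derive_mx (M := id)) ?mxE//.
Qed.

Lemma derive_comp1 (f : 'rV[R]_3 -> R) (h : R -> R) (x v : 'rV[R]_3) dh :
  differentiable f x -> is_derive (f x) 1 h dh ->
  'D_v (fun y => h (f y)) x = dh * 'D_v f x.
Proof.
move=> df [dfh <-]; have dh' := (derivable1_diffP _ _).1 dfh.
rewrite (deriveE v (differentiable_comp df dh')) (deriveE v df).
by rewrite diff_comp//= diff1E// derive1E mulrC.
Qed.

Lemma partial_tpeval (k : 'I_3) e x :
  partial k (tpeval e) x = tpeval (tpderiv k e) x.
Proof.
have dc i := @differentiable_coord R 1 3 x 0 i.
rewrite /partial; elim: e => [a||||||e1 d1 e2 d2|e1 d1 e2 d2].
- exact: derive_cst.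
- by rewrite derive_coord mxE /= eq_sym.
- rewrite (derive_comp1 _ (dc 1) (is_derive_cos _)) derive_coord mxE.
  by case: k => -[|[|[|]]] //= kP; ring.
- rewrite (derive_comp1 _ (dc 1) (is_derive_sin _)) derive_coord mxE.
  by case: k => -[|[|[|]]] //= kP; ring.
- rewrite (derive_comp1 _ (dc 2) (is_derive_cos _)) derive_coord mxE.
  by case: k => -[|[|[|]]] //= kP; ring.
- rewrite (derive_comp1 _ (dc 2) (is_derive_sin _)) derive_coord mxE.
  by case: k => -[|[|[|]]] //= kP; ring.
- rewrite (deriveD (f := tpeval e1) (g := tpeval e2)); first by rewrite d1 d2.
    exact/diff_derivable/tpeval_differentiable.
  exact/diff_derivable/tpeval_differentiable.
- rewrite (deriveM (f := tpeval e1) (g := tpeval e2)).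
      by rewrite d1 d2 /GRing.scale /=; ring.
    exact/diff_derivable/tpeval_differentiable.
  exact/diff_derivable/tpeval_differentiable.
Qed.

End TrigonometricPolynomials.

(** * The induced metric of the kinematic surface *)

Section KinematicMetric.
Set Implicit Arguments.
Unset Strict Implicit.
Variables (R : realType) (s : R) (w b : nat -> R).

(** Entry [i] is the i-th column of C, the derivative in t of the i-th frame vector [a0], [a1] or
    [a2]. *)
Definition slice_velocity (i : nat) : seq R :=
  nth [::] [:: [:: s; - w 1; - w 2; - w 3; - w 4; - w 5; - w 6];
               [:: w 1; s; - w 7; - w 8; - w 9; - w 10; - w 11];
               [:: w 2; w 7; s; - w 12; - w 13; - w 14; - w 15]]%N i.

Local Notation "e1 'p+' e2" := (TPadd e1 e2) (at level 50, left associativity).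
Local Notation "e1 'p*' e2" := (TPmul e1 e2) (at level 40, left associativity).
Local Notation T := (TPtime R).
Local Notation "'cT'" := (TPcos_theta R).
Local Notation "'sT'" := (TPsin_theta R).
Local Notation "'cP'" := (TPcos_phi R).
Local Notation "'sP'" := (TPsin_phi R).
Local Notation K := (@TPconst R).

Definition surface_poly (k : nat) : trigpoly R :=
  K (b k.+1) p* T
  p+ cT p* cP p* (K (k == 0%N)%:R p+ K (slice_velocity 0)`_k p* T)
  p+ sT p* cP p* (K (k == 1%N)%:R p+ K (slice_velocity 1)`_k p* T)
  p+ sP p* (K (k == 2%N)%:R p+ K (slice_velocity 2)`_k p* T).

Lemma kinematic_surfaceE x (k : 'I_7) :
  kinematic_surface s w b x 0 k = tpeval (surface_poly k) x.
Proof.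
rewrite !mxE; case: k => -[|[|[|[|[|[|[|]]]]]]] //= kP; ring.
Qed.

Lemma partial_kinematic_surface i x (k : 'I_7) :
  partial i (kinematic_surface s w b) x 0 k = tpeval (tpderiv i (surface_poly k)) x.
Proof.
have E l : (fun y => kinematic_surface s w b y 0 l) = tpeval (surface_poly l).
  by apply/funext => y; exact: kinematic_surfaceE.
rewrite -partial_tpeval /partial derive_mx ?mxE ?E//.
apply/derivable_mxP => j l; rewrite ord1 E.
exact/diff_derivable/tpeval_differentiable.
Qed.

(** The sums stay nested to the right, as unfolding the big operators leaves them, so that these
    equations rewrite syntactically in [gram_defect]. *)
Lemma spherical_slicesE : spherical_slices w ->
  [/\ w 2%N * w 7%N + (w 3%N * w 8%N + (w 4%N * w 9%N + (w 5%N * w 10%N + w 6%N * w 11%N))) = 0,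
      w 1%N * w 7%N - (w 3%N * w 12%N + (w 4%N * w 13%N + (w 5%N * w 14%N + w 6%N * w 15%N))) = 0,
      w 1%N * w 2%N + (w 8%N * w 12%N + (w 9%N * w 13%N + (w 10%N * w 14%N + w 11%N * w 15%N))) = 0,
      w 2%N ^+ 2 + (w 3%N ^+ 2 + (w 4%N ^+ 2 + (w 5%N ^+ 2 + w 6%N ^+ 2)))
       = w 7%N ^+ 2 + (w 8%N ^+ 2 + (w 9%N ^+ 2 + (w 10%N ^+ 2 + w 11%N ^+ 2))) &
      w 1%N ^+ 2 + (w 3%N ^+ 2 + (w 4%N ^+ 2 + (w 5%N ^+ 2 + w 6%N ^+ 2)))
       = w 7%N ^+ 2 + (w 12%N ^+ 2 + (w 13%N ^+ 2 + (w 14%N ^+ 2 + w 15%N ^+ 2)))].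
Proof. by rewrite /spherical_slices unlock /= !addr0. Qed.

(* speed2 = L = |C n|^2 for every unit vector n, and drift_i is the i-th component
   of beta = C^T b. *)
Definition speed2 : R := s ^+ 2 + w 1%N ^+ 2 + w 2%N ^+ 2
  + (w 3%N ^+ 2 + (w 4%N ^+ 2 + (w 5%N ^+ 2 + w 6%N ^+ 2))).
Definition drift0 : R := - (b 4%N * w 3%N + (b 5%N * w 4%N + (b 6%N * w 5%N + b 7%N * w 6%N))).
Definition drift1 : R := - (b 4%N * w 8%N + (b 5%N * w 9%N + (b 6%N * w 10%N + b 7%N * w 11%N))).
Definition drift2 : R := - (b 4%N * w 12%N + (b 5%N * w 13%N + (b 6%N * w 14%N + b 7%N * w 15%N))).

(** Entries (0,1) and (0,2) pair t beta + W n with the theta- and phi-derivatives of n; these two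
    derivatives are orthogonal, of lengths |cos phi| and 1. *)
Definition metric_poly (i j : nat) : trigpoly R :=
  match i, j with
  | 0%N, 0%N =>
      K (b 4%N ^+ 2 + (b 5%N ^+ 2 + (b 6%N ^+ 2 + b 7%N ^+ 2)) + speed2)
      p+ K 2 p* ((K drift0 p* cT p+ K drift1 p* sT) p* cP p+ K drift2 p* sP)
  | 0%N, 1%N | 1%N, 0%N =>
      T p* ((K drift1 p* cT p+ K (- drift0) p* sT) p* cP)
      p+ (K (- w 1%N) p* (cP p* cP)
          p+ sP p* cP p* (K (w 7%N) p* cT p+ K (- w 2%N) p* sT))
  | 0%N, 2%N | 2%N, 0%N =>
      T p* (K (-1) p* (K drift0 p* cT p+ K drift1 p* sT) p* sP p+ K drift2 p* cP)
      p+ K (-1) p* (K (w 2%N) p* cT p+ K (w 7%N) p* sT)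
  | 1%N, 1%N => (K 1 p+ K (2 * s) p* T p+ K speed2 p* (T p* T)) p* (cP p* cP)
  | 2%N, 2%N => K 1 p+ K (2 * s) p* T p+ K speed2 p* (T p* T)
  | _, _ => K 0
  end.

(* Vanishes by the slice conditions; equals C n . C m - L (n . m). *)
Let gram_defect n0 n1 n2 m0 m1 m2 : R :=
  (n0 * m1 + n1 * m0)
    * (w 2%N * w 7%N + (w 3%N * w 8%N + (w 4%N * w 9%N
      + (w 5%N * w 10%N + w 6%N * w 11%N))))
  - (n0 * m2 + n2 * m0)
    * (w 1%N * w 7%N - (w 3%N * w 12%N + (w 4%N * w 13%N
      + (w 5%N * w 14%N + w 6%N * w 15%N))))
  + (n1 * m2 + n2 * m1)
    * (w 1%N * w 2%N + (w 8%N * w 12%N + (w 9%N * w 13%N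
      + (w 10%N * w 14%N + w 11%N * w 15%N))))
  - n1 * m1 * ((w 2%N ^+ 2 + (w 3%N ^+ 2 + (w 4%N ^+ 2 + (w 5%N ^+ 2 + w 6%N ^+ 2))))
    - (w 7%N ^+ 2 + (w 8%N ^+ 2 + (w 9%N ^+ 2 + (w 10%N ^+ 2 + w 11%N ^+ 2)))))
  - n2 * m2 * ((w 1%N ^+ 2 + (w 3%N ^+ 2 + (w 4%N ^+ 2 + (w 5%N ^+ 2 + w 6%N ^+ 2))))
    - (w 7%N ^+ 2 + (w 12%N ^+ 2 + (w 13%N ^+ 2 + (w 14%N ^+ 2 + w 15%N ^+ 2))))).

Hypothesis Hslices : spherical_slices w.
Hypothesis Hb : no_starting_translation b.

Let gram_defect0 n0 n1 n2 m0 m1 m2 : gram_defect n0 n1 n2 m0 m1 m2 = 0.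
Proof.
have [H1 H2 H3 H4 H5] := spherical_slicesE Hslices.
by rewrite /gram_defect H1 H2 H3 H4 H5; ring.
Qed.

Lemma induced_metricE x i j :
  induced_metric (kinematic_surface s w b) x i j = tpeval (metric_poly i j) x.
Proof.
wlog ij : i j / (i <= j)%N => [H|].
  have [ij|/ltnW ij] := leqP i j; first exact: H.
  have -> : metric_poly i j = metric_poly j i.
    by case: i j {ij} => -[|[|[|]]] // ? [[|[|[|]]]].
  by rewrite -(H j i ij) mxE [RHS]mxE; exact: dotC.
rewrite mxE /dot.
transitivity (\sum_(k < 7) tpeval (tpderiv i (surface_poly k)) x *
                             tpeval (tpderiv j (surface_poly k)) x).
  by apply: eq_bigr => k _; congr (_ * _); exact: partial_kinematic_surface.
have [b1 b2 b3] := Hb.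
rewrite !big_ord_recl big_ord0.
have := cos2Dsin2 (x 0 1); have := cos2Dsin2 (x 0 2).
case: i j ij => -[|[|[|iP]]] //= _ [[|[|[|jP]]]] //= _ _;
  rewrite b1 b2 b3 /bump /= !add1n !addr0;
  move: (cos (x 0 1)) (sin (x 0 1)) (cos (x 0 2)) (sin (x 0 2)) (x 0 0);
  move=> ct st cp sp t trP trT;
  apply: subr0_eq.
(* In each case the difference of the two sides is an explicit combination of [gram_defect], taken
   at n and its angular derivatives, and, where needed, of the Pythagorean relations in theta and
   phi. *)
- transitivity (gram_defect (ct * cp) (st * cp) sp (ct * cp) (st * cp) sp
    + speed2 * (cp ^+ 2 * (ct ^+ 2 + st ^+ 2 - 1) + (cp ^+ 2 + sp ^+ 2 - 1))).
    by rewrite /gram_defect /speed2 /drift0 /drift1 /drift2; ring.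
  by rewrite gram_defect0 trT trP; ring.
- transitivity (t * gram_defect (- st * cp) (ct * cp) 0 (ct * cp) (st * cp) sp
    - w 1%N * cp ^+ 2 * (ct ^+ 2 + st ^+ 2 - 1)).
    by rewrite /gram_defect /speed2 /drift0 /drift1 /drift2; ring.
  by rewrite gram_defect0 trT; ring.
- transitivity (t * gram_defect (- ct * sp) (- st * sp) cp (ct * cp) (st * cp) sp
    - (t * speed2 + s) * cp * sp * (ct ^+ 2 + st ^+ 2 - 1)
    - (w 2%N * ct + w 7%N * st) * (cp ^+ 2 + sp ^+ 2 - 1)).
    by rewrite /gram_defect /speed2 /drift0 /drift1 /drift2; ring.
  by rewrite gram_defect0 trT trP; ring.
- transitivity (t ^+ 2 * gram_defect (- st * cp) (ct * cp) 0 (- st * cp) (ct * cp) 0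
    + (1 + 2 * s * t + speed2 * t ^+ 2) * cp ^+ 2 * (ct ^+ 2 + st ^+ 2 - 1)).
    by rewrite /gram_defect /speed2; ring.
  by rewrite gram_defect0 trT; ring.
- transitivity (t ^+ 2 * gram_defect (- st * cp) (ct * cp) 0 (- ct * sp) (- st * sp) cp).
    by rewrite /gram_defect; ring.
  by rewrite gram_defect0; ring.
- transitivity (t ^+ 2 * gram_defect (- ct * sp) (- st * sp) cp (- ct * sp) (- st * sp) cp
    + (1 + 2 * s * t + speed2 * t ^+ 2)
      * (sp ^+ 2 * (ct ^+ 2 + st ^+ 2 - 1) + (cp ^+ 2 + sp ^+ 2 - 1))).
    by rewrite /gram_defect /speed2; ring.
  by rewrite gram_defect0 trT trP; ring.
Qed.

End KinematicMetric.

(** * Scalar curvature as an algebraic function of the 2-jet of the metric *)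

Section CurvatureAtZero.
Set Implicit Arguments.
Unset Strict Implicit.
Variable R : realType.

(* Sums over concrete indices compute, unlike the opaque bigops. *)
Definition sum3 (F : nat -> R) : R := F 0%N + F 1%N + F 2%N.

Section Jet.
Variables (h : nat -> nat -> R) (g1 : nat -> nat -> nat -> R).
Variables (g2 : nat -> nat -> nat -> nat -> R).

(** Here [h] stands for the inverse metric at a point, [g1] and [g2] for the first and second
    partials of the metric; [jet_dchristoffel] below mirrors [partial_christoffel]. *)
Definition jet_christoffel (l i j : nat) : R :=
  2^-1 * sum3 (fun m => h l m * (g1 i j m + g1 j i m - g1 m i j)).

Definition jet_dchristoffel (d l i j : nat) : R :=
  sum3 (fun p => h l p * (2^-1 * (g2 d i j p + g2 d j i p - g2 d p i j)
    - sum3 (fun q => g1 d p q * jet_christoffel q i j))).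

Definition jet_curvature : R :=
  sum3 (fun i => sum3 (fun j => h i j *
    sum3 (fun l => jet_dchristoffel l l i j - jet_dchristoffel j l i l
      + sum3 (fun m => jet_christoffel l i j * jet_christoffel m l m
          - jet_christoffel m i l * jet_christoffel l j m)))).

End Jet.

Section Tables.
Variables (s w1 L c z p q r u v D : R).

(* The metric at t = 0 and its partial derivatives of order at most two, where
   c = cos phi, z = sin phi, beta.n = p c + r z with theta-derivative q c, and W n
   has components z v - c w1 and - u in the unit theta and phi directions.
   D stands for the inverse of the squared lapse g_tt - |W n|^2; keeping D instead
   of g_tt makes the curvature polynomial in D. *)
Definition jet0 (i j : nat) : R :=
  nth 0 (nth [::]
    [:: [:: D^-1 + (c * w1 - z * v) ^+ 2 + u ^+ 2; - w1 * c ^+ 2 + z * c * v; - u];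
        [:: - w1 * c ^+ 2 + z * c * v; c ^+ 2; 0];
        [:: - u; 0; 1]] i) j.

(** Lapse-shift form of the inverse: [shift] is (-1, N) with N the shift vector, and the last
    summand is the inverse of the round metric on the sphere. *)
Definition jet_inv (i j : nat) : R :=
  let shift k := nth 0 [:: -1; - w1 + z / c * v; - u] k in
  shift i * shift j * D
  + nth 0 (nth [::] [:: [:: 0; 0; 0]; [:: 0; c ^- 2; 0]; [:: 0; 0; 1]] i) j.

(** Both tables of derivatives use p' = q, q' = -p, u' = v, v' = -u in theta and c' = -z, z' = c in
    phi. *)
Definition jet1 (k i j : nat) : R :=
  match k, i, j with
  | 0%N, 0%N, 1%N | 0%N, 1%N, 0%N => q * c
  | 0%N, 0%N, 2%N | 0%N, 2%N, 0%N => r * c - p * z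
  | 0%N, 1%N, 1%N => 2 * s * c ^+ 2
  | 0%N, 2%N, 2%N => 2 * s
  | 1%N, 0%N, 0%N => 2 * q * c
  | 1%N, 0%N, 1%N | 1%N, 1%N, 0%N => - (z * c * u)
  | 1%N, 0%N, 2%N | 1%N, 2%N, 0%N => - v
  | 2%N, 0%N, 0%N => 2 * (r * c - p * z)
  | 2%N, 0%N, 1%N | 2%N, 1%N, 0%N => 2 * w1 * c * z + (c ^+ 2 - z ^+ 2) * v
  | 2%N, 1%N, 1%N => - (2 * c * z)
  | _, _, _ => 0
  end.

Definition jet2 (d k i j : nat) : R :=
  match d, k with
  | 0%N, 0%N =>
    match i, j with
    | 1%N, 1%N => 2 * L * c ^+ 2
    | 2%N, 2%N => 2 * L
    | _, _ => 0
    end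
  | 0%N, 1%N | 1%N, 0%N =>
    match i, j with
    | 0%N, 1%N | 1%N, 0%N => - (p * c)
    | 0%N, 2%N | 2%N, 0%N => - (q * z)
    | _, _ => 0
    end
  | 0%N, 2%N | 2%N, 0%N =>
    match i, j with
    | 0%N, 1%N | 1%N, 0%N => - (q * z)
    | 0%N, 2%N | 2%N, 0%N => - (p * c + r * z)
    | 1%N, 1%N => - (4 * s * c * z)
    | _, _ => 0
    end
  | 1%N, 1%N =>
    match i, j with
    | 0%N, 0%N => - (2 * p * c)
    | 0%N, 1%N | 1%N, 0%N => - (z * c * v)
    | 0%N, 2%N | 2%N, 0%N => u
    | _, _ => 0
    end
  | 1%N, 2%N | 2%N, 1%N =>
    match i, j with
    | 0%N, 0%N => - (2 * q * z)
    | 0%N, 1%N | 1%N, 0%N => - ((c ^+ 2 - z ^+ 2) * u)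
    | _, _ => 0
    end
  | 2%N, 2%N =>
    match i, j with
    | 0%N, 0%N => - (2 * (p * c + r * z))
    | 0%N, 1%N | 1%N, 0%N => 2 * w1 * (c ^+ 2 - z ^+ 2) - 4 * c * z * v
    | 1%N, 1%N => - (2 * (c ^+ 2 - z ^+ 2))
    | _, _ => 0
    end
  | _, _ => 0
  end.

End Tables.

Lemma jet_mul_inv w1 c z u v D i j : c != 0 -> D != 0 ->
  (i < 3)%N -> (j < 3)%N ->
  sum3 (fun k => jet0 w1 c z u v D i k * jet_inv w1 c z u v D k j) = (i == j)%:R :> R.
Proof.
move=> c0 D0; rewrite /sum3 /jet0 /jet_inv.
by case: i => [|[|[|]]] //= _; case: j => [|[|[|]]] //= _; field; rewrite ?c0 ?D0.
Qed.

Lemma equator_jet_curvature s w1 L p q r u v D :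
  jet_curvature (jet_inv w1 1 0 u v D) (jet1 s w1 1 0 p q r u v)
    (jet2 s w1 L 1 0 p q r u v) =
  2 + (2 * s ^+ 2 - 4 * L - 2 * w1 ^+ 2 - 2 * u ^+ 2 + 4 * v ^+ 2) * D
  + (4 * s ^+ 2 * (w1 ^+ 2 + u ^+ 2) + 8 * s * (w1 * q + u * r) + 2 * (q ^+ 2 + r ^+ 2)
     + 4 * v * (w1 * r - u * q) + 2 * v ^+ 2 * (w1 ^+ 2 + u ^+ 2)) * D ^+ 2 :> R.
Proof.
(* The restricted unfolding keeps the operations of [R] folded, so that [field] recognises the
   result. *)
cbv beta iota zeta delta [jet_curvature jet_dchristoffel sum3 jet_inv jet1 jet2
  jet_christoffel nth].
by field; rewrite ?oner_neq0.
Qed.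

(** The case of omega and beta along the polar axis: p, q, u, v vanish and the metric no longer
    depends on theta. *)
Lemma axial_jet_curvature s w1 L c z r D : c != 0 ->
  jet_curvature (jet_inv w1 c z 0 0 D) (jet1 s w1 c z 0 0 r 0 0)
    (jet2 s w1 L c z 0 0 r 0 0) =
  2 + (2 * s ^+ 2 - 4 * L - 2 * w1 ^+ 2 * c ^+ 2 + 4 * w1 ^+ 2 * z ^+ 2) * D
  + (2 * r ^+ 2 + 4 * r * w1 ^+ 2 * z + 2 * w1 ^+ 4 * z ^+ 2 + 4 * w1 ^+ 2 * s ^+ 2)
    * c ^+ 2 * D ^+ 2 :> R.
Proof.
move=> c0.
cbv beta iota zeta delta [jet_curvature jet_dchristoffel sum3 jet_inv jet1 jet2
  jet_christoffel nth].
by field; rewrite ?oner_neq0.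
Qed.

End CurvatureAtZero.

(** * Curvature of the kinematic surface at t = 0 *)

Section KinematicCurvature.
Set Implicit Arguments.
Unset Strict Implicit.
Variables (R : realType) (s : R) (w b : nat -> R).
Hypothesis Hslices : spherical_slices w.
Hypothesis Hb : no_starting_translation b.
Variables theta phi : R.

Local Notation X := (kinematic_surface s w b).
Local Notation g := (induced_metric X).
Local Notation x := (point_at_zero theta phi).
Local Notation c := (cos phi).
Local Notation z := (sin phi).
Local Notation p := (drift0 w b * cos theta + drift1 w b * sin theta).
Local Notation q := (drift1 w b * cos theta - drift0 w b * sin theta).
Local Notation r := (drift2 w b).
Local Notation u := (w 2%N * cos theta + w 7%N * sin theta).
Local Notation v := (w 7%N * cos theta - w 2%N * sin theta).
Local Notation w1 := (w 1%N).

(** This is Q, the Schur complement g_tt - |W n|^2 of the angular block; the two subtracted squares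
    add up to |W n|^2. *)
Definition lapse2 : R :=
  b 4%N ^+ 2 + (b 5%N ^+ 2 + (b 6%N ^+ 2 + b 7%N ^+ 2)) + speed2 s w
  + 2 * (p * c + r * z) - (c * w1 - z * v) ^+ 2 - u ^+ 2.

Local Notation j0 := (jet0 w1 c z u v lapse2^-1).
Local Notation jinv := (jet_inv w1 c z u v lapse2^-1).
Local Notation j1 := (jet1 s w1 c z p q r u v).
Local Notation j2 := (jet2 s w1 (speed2 s w) c z p q r u v).

Let x0 : x 0 0 = 0. Proof. by rewrite mxE. Qed.
Let x1 : x 0 1 = theta. Proof. by rewrite mxE. Qed.
Let x2 : x 0 2 = phi. Proof. by rewrite mxE. Qed.

Lemma metric_jet0 (i j : 'I_3) : g x i j = j0 i j.
Proof.
rewrite (induced_metricE s Hslices Hb) /jet0 invrK /lapse2.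
by case: i => -[|[|[|]]] //= _; case: j => -[|[|[|]]] //= _; rewrite ?x0 ?x1 ?x2; ring.
Qed.

Lemma metric_jet1 (k i j : 'I_3) : tpeval (tpderiv k (metric_poly s w b i j)) x = j1 k i j.
Proof.
by case: k => -[|[|[|]]] //= _; case: i => -[|[|[|]]] //= _; case: j => -[|[|[|]]] //= _;
  rewrite ?x0 ?x1 ?x2; ring.
Qed.

Lemma metric_jet2 (d k i j : 'I_3) :
  tpeval (tpderiv d (tpderiv k (metric_poly s w b i j))) x = j2 d k i j.
Proof.
by case: d => -[|[|[|]]] //= _; case: k => -[|[|[|]]] //= _;
  case: i => -[|[|[|]]] //= _; case: j => -[|[|[|]]] //= _;
  rewrite ?x0 ?x1 ?x2; ring.
Qed.

Hypothesis c0 : c != 0.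
Hypothesis gx_unit : g x \in unitmx.

Lemma sum3E (F : nat -> R) : \sum_(i < 3) F i = sum3 F.
Proof. by rewrite !big_ord_recl big_ord0 addr0 addrA. Qed.

(** If Q were 0, the vector (1, -N) with N the shift would be a null vector of the invertible
    metric. The double inverse in [jet0] is harmless, since inversion is an involution at 0 too. *)
Lemma lapse2_neq0 : lapse2 != 0.
Proof.
apply/eqP => Q0; have D0 : lapse2^-1^-1 = 0 by rewrite invrK.
pose n : 'rV[R]_3 := \row_k nth 0 [:: 1; w1 - z / c * v; u] k.
have n0 : n *m g x = 0.
  apply/rowP => j; rewrite [RHS]mxE.
  transitivity (sum3 (fun k => nth 0 [:: 1; w1 - z / c * v; u] k * j0 k j)).
    by rewrite -sum3E mxE; apply: eq_bigr => k _; rewrite metric_jet0 mxE.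
  by rewrite /sum3 /jet0 D0; case: j => -[|[|[|]]] //= _; field.
have /rowP/(_ 0) : n = 0 by rewrite -[n](mulmxK gx_unit) n0 mul0mx.
by rewrite !mxE /= => /eqP; rewrite oner_eq0.
Qed.

Lemma invmx_metric (i j : 'I_3) : invmx (g x) i j = jinv i j.
Proof.
pose h : 'M[R]_3 := \matrix_(i, j) jinv i j.
suff E : g x *m h = 1%:M.
  by rewrite -[invmx _]mulmx1 -E (mulKmx gx_unit) mxE.
apply/matrixP => k l; rewrite mxE [RHS]mxE.
rewrite -(jet_mul_inv w1 z u v c0 (invr_neq0 lapse2_neq0) (ltn_ord k) (ltn_ord l)).
rewrite -sum3E; apply: eq_bigr => m _.
by rewrite metric_jet0 mxE.
Qed.

Lemma partial_metric k i j y :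
  partial k (fun y => g y i j) y = tpeval (tpderiv k (metric_poly s w b i j)) y.
Proof.
rewrite -partial_tpeval; congr partial.
by apply/funext => t; exact: induced_metricE.
Qed.

Lemma christoffel_jet l i j : christoffel g l i j x = jet_christoffel jinv j1 l i j.
Proof.
rewrite /christoffel /jet_christoffel -sum3E; congr (_ * _); apply: eq_bigr => m _.
by rewrite invmx_metric !partial_metric !metric_jet1.
Qed.

Lemma partial_christoffel_jet d l i j :
  partial d (christoffel g l i j) x = jet_dchristoffel jinv j1 j2 d l i j.
Proof.
rewrite (@partial_christoffel _ _ _
  (fun k i j => tpeval (tpderiv k (metric_poly s w b i j)))) //; first last.
- by move=> *; exact: tpeval_differentiable.
- exact: partial_metric.
- move=> i' j' y; have -> : (fun y => g y i' j') = tpeval (metric_poly s w b i' j').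
    by apply/funext => t; exact: induced_metricE.
  exact: tpeval_differentiable.
rewrite /jet_dchristoffel -sum3E; apply: eq_bigr => k _.
rewrite invmx_metric !partial_tpeval !metric_jet2 -sum3E.
congr (_ * (_ - _)); apply: eq_bigr => m _.
by rewrite metric_jet1 christoffel_jet.
Qed.

Lemma scalar_curvature_jet : scalar_curvature g x = jet_curvature jinv j1 j2.
Proof.
rewrite /scalar_curvature /jet_curvature -sum3E; apply: eq_bigr => i _.
rewrite -sum3E; apply: eq_bigr => j _.
rewrite invmx_metric -sum3E; congr (_ * _); apply: eq_bigr => l _.
rewrite !partial_christoffel_jet -sum3E; congr (_ + _); apply: eq_bigr => m _.
by rewrite !christoffel_jet.
Qed.

End KinematicCurvature.

(** * Rigidity from vanishing on the equator and on a meridian *)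

Section Harmonics.
Set Implicit Arguments.
Unset Strict Implicit.
Variable R : realType.

Lemma circle_angle (a b : R) : a ^+ 2 + b ^+ 2 = 1 ->
  exists theta, cos theta = a /\ sin theta = b.
Proof.
move=> ab.
have a1 : -1 <= a <= 1.
  by rewrite -ler_norml -(@expr_le1 _ 2)// real_normK ?num_real//; have := sqr_ge0 b; lra.
have sE : sin (acos a) = `|b|.
  by rewrite sin_acos// -sqrtr_sqr; congr Num.sqrt; lra.
have [b0|b0] := leP 0 b.
  by exists (acos a); rewrite acosK// sE ger0_norm.
by exists (- acos a); rewrite cosN acosK// sinN sE ltr0_norm// opprK.
Qed.

(** The hypotheses say that the real and imaginary parts of (x + i y)^4 vanish. *)
Lemma fourth_harmonic_eq0 (x y : R) :
  x ^+ 4 + y ^+ 4 = 6 * x ^+ 2 * y ^+ 2 -> x * y * (y ^+ 2 - x ^+ 2) = 0 ->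
  x = 0 /\ y = 0.
Proof.
move=> H1 /eqP; rewrite !mulf_eq0.
have root4 (a : R) : a ^+ 4 = 0 -> a = 0 by move/eqP; rewrite expf_eq0 => /eqP.
move=> /orP[/orP[]|] /eqP E.
- by subst x; split=> //; apply: root4; lra.
- by subst y; split=> //; apply: root4; lra.
- have yx : y ^+ 2 = x ^+ 2 by lra.
  have y4 : y ^+ 4 = x ^+ 4 by rewrite (exprM y 2 2) yx -exprM.
  have x0 : x = 0 by apply: root4; rewrite yx y4 in H1; lra.
  by split=> //; apply: root4; rewrite y4 x0 expr0n.
Qed.

Lemma equator_rigidity (A s L w1 w2 w7 d0 d1 r : R) :
  (forall n0 n1 : R, n0 ^+ 2 + n1 ^+ 2 = 1 ->
    let p := d0 * n0 + d1 * n1 in let q := d1 * n0 - d0 * n1 in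
    let u := w2 * n0 + w7 * n1 in let v := w7 * n0 - w2 * n1 in
    let Q := A + 2 * p - w1 ^+ 2 - u ^+ 2 in
    2 * Q ^+ 2 + (2 * s ^+ 2 - 4 * L - 2 * w1 ^+ 2 - 2 * u ^+ 2 + 4 * v ^+ 2) * Q
    + (4 * s ^+ 2 * (w1 ^+ 2 + u ^+ 2) + 8 * s * (w1 * q + u * r) + 2 * (q ^+ 2 + r ^+ 2)
     + 4 * v * (w1 * r - u * q) + 2 * v ^+ 2 * (w1 ^+ 2 + u ^+ 2)) = 0) ->
  [/\ w2 = 0, w7 = 0, d0 = 0 & d1 = 0].
Proof.
move=> H.
pose rho := w2 ^+ 2 + w7 ^+ 2; pose beta2 := d0 ^+ 2 + d1 ^+ 2.
pose a := A - w1 ^+ 2 - rho.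
pose e := 2 * s ^+ 2 - 4 * L - 2 * w1 ^+ 2 - 2 * rho.
pose k := 10 * a + e - 4 * s ^+ 2 + 2 * (w1 ^+ 2 + rho).
pose C := 2 * a ^+ 2 + 2 * beta2 + 2 * r ^+ 2 + a * e + 4 * s ^+ 2 * (w1 ^+ 2 + rho).
(* Average the equation over n and -n, then eliminate u and q by u^2 + v^2 = [rho] and p^2 + q^2 =
   [beta2]. *)
have even_part n0 n1 : n0 ^+ 2 + n1 ^+ 2 = 1 ->
    6 * (w7 * n0 - w2 * n1) ^+ 4 + k * (w7 * n0 - w2 * n1) ^+ 2
    + 6 * (d0 * n0 + d1 * n1) ^+ 2 + C = 0.
  move=> n01; have n01N : (- n0) ^+ 2 + (- n1) ^+ 2 = 1 by rewrite !sqrrN.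
  pose p := d0 * n0 + d1 * n1; pose q := d1 * n0 - d0 * n1.
  pose u := w2 * n0 + w7 * n1; pose v := w7 * n0 - w2 * n1.
  have rhoE : rho = u ^+ 2 + v ^+ 2.
    by rewrite -[rho]mulr1 -n01 /rho /u /v; ring.
  have beta2E : beta2 = q ^+ 2 + p ^+ 2.
    by rewrite -[beta2]mulr1 -n01 /beta2 /p /q; ring.
  pose P p q u v := let Q := A + 2 * p - w1 ^+ 2 - u ^+ 2 in
    2 * Q ^+ 2 + (2 * s ^+ 2 - 4 * L - 2 * w1 ^+ 2 - 2 * u ^+ 2 + 4 * v ^+ 2) * Q
    + (4 * s ^+ 2 * (w1 ^+ 2 + u ^+ 2) + 8 * s * (w1 * q + u * r) + 2 * (q ^+ 2 + r ^+ 2)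
     + 4 * v * (w1 * r - u * q) + 2 * v ^+ 2 * (w1 ^+ 2 + u ^+ 2)).
  have P0 : P p q u v = 0 := H _ _ n01.
  have P0N : P (- p) (- q) (- u) (- v) = 0.
    by rewrite -[RHS](H _ _ n01N) /P /p /q /u /v; cbv zeta; ring.
  transitivity ((P p q u v + P (- p) (- q) (- u) (- v)) / 2).
    rewrite -/p -/v /P /C /k /e /a rhoE beta2E; cbv zeta.
    by clearbody p q u v; field.
  by rewrite P0 P0N addr0 mul0r.
(* Rational points of the circle in three orthogonal pairs. Adding the two values of a pair cancels
   the second harmonics, so the three sums differ by fourth harmonics alone. *)
have e1 : (1 : R) ^+ 2 + 0 ^+ 2 = 1 by ring.
have e2 : (0 : R) ^+ 2 + 1 ^+ 2 = 1 by ring.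
have e3 : (3 / 5 : R) ^+ 2 + (4 / 5) ^+ 2 = 1 by field.
have e4 : (4 / 5 : R) ^+ 2 + (- (3 / 5)) ^+ 2 = 1 by field.
have e5 : (3 / 5 : R) ^+ 2 + (- (4 / 5)) ^+ 2 = 1 by field.
have e6 : (4 / 5 : R) ^+ 2 + (3 / 5) ^+ 2 = 1 by field.
move: (even_part _ _ e1) (even_part _ _ e2) (even_part _ _ e3).
move: (even_part _ _ e4) (even_part _ _ e5) (even_part _ _ e6).
clearbody k C; clear => E4 E5 E6 E1 E2 E3.
have X1 : w2 ^+ 4 + w7 ^+ 4 = 6 * w2 ^+ 2 * w7 ^+ 2 by lra.
have X2 : w2 * w7 * (w7 ^+ 2 - w2 ^+ 2) = 0 by lra.
have [w20 w70] := fourth_harmonic_eq0 X1 X2.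
subst w2 w7.
(* Only 6 p^2 + [C] is left; its second harmonic vanishes, that is, (d0 + i d1)^2 = 0. *)
have Y1 : d0 ^+ 2 = d1 ^+ 2 by lra.
have Y2 : d0 * d1 = 0 by lra.
move/eqP: Y2; rewrite mulf_eq0 => /orP[] /eqP E; move: Y1; rewrite E expr0n /=.
  by move/esym/eqP; rewrite sqrf_eq0 => /eqP ->.
by move/eqP; rewrite sqrf_eq0 => /eqP ->.
Qed.

(** With c^2 = 1 - z^2 the left side is a polynomial of degree at most 4 in z, with z^4 coefficient
    6 w1^4; for w1 = 0 it has degree at most 2, with z^2 coefficient 6 r^2. The five rational zeros
    z = 0, 3/5, -3/5, 4/5, -4/5 make both coefficients vanish. *)
Lemma axial_rigidity (A s L w1 r : R) :
  (forall c z : R, c != 0 -> c ^+ 2 + z ^+ 2 = 1 ->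
    let Q := A + 2 * r * z - w1 ^+ 2 * c ^+ 2 in
    2 * Q ^+ 2 + (2 * s ^+ 2 - 4 * L - 2 * w1 ^+ 2 * c ^+ 2 + 4 * w1 ^+ 2 * z ^+ 2) * Q
    + (2 * r ^+ 2 + 4 * r * w1 ^+ 2 * z + 2 * w1 ^+ 4 * z ^+ 2 + 4 * w1 ^+ 2 * s ^+ 2)
      * c ^+ 2 = 0) ->
  w1 = 0 /\ r = 0.
Proof.
move=> H.
have c3 : (3 / 5 : R) != 0 by apply/eqP; lra.
have c4 : (4 / 5 : R) != 0 by apply/eqP; lra.
have e0 : (1 : R) ^+ 2 + 0 ^+ 2 = 1 by ring.
have e1 : (4 / 5 : R) ^+ 2 + (3 / 5) ^+ 2 = 1 by field.
have e2 : (4 / 5 : R) ^+ 2 + (- (3 / 5)) ^+ 2 = 1 by field.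
have e3 : (3 / 5 : R) ^+ 2 + (4 / 5) ^+ 2 = 1 by field.
have e4 : (3 / 5 : R) ^+ 2 + (- (4 / 5)) ^+ 2 = 1 by field.
move: (H _ _ (oner_neq0 R) e0) (H _ _ c4 e1) (H _ _ c4 e2) (H _ _ c3 e3) (H _ _ c3 e4).
cbv zeta; clear => F0 F1 F2 F3 F4.
have : w1 ^+ 4 = 0 by lra.
move/eqP; rewrite expf_eq0 => /eqP w10; subst w1; split=> //.
have : r ^+ 2 = 0 by lra.
by move/eqP; rewrite sqrf_eq0 => /eqP.
Qed.

End Harmonics.

(** * From zero curvature to the relations among the parameters *)

Lemma quadratic_of_inverse (R : realType) (Q a b : R) : Q != 0 ->
  2 + a * Q^-1 + b * Q^-1 ^+ 2 = 0 -> 2 * Q ^+ 2 + a * Q + b = 0.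
Proof.
move=> Q0 E; transitivity (Q ^+ 2 * (2 + a * Q^-1 + b * Q^-1 ^+ 2)); last by rewrite E mulr0.
by field.
Qed.

Theorem theorem3p1 (R : realType) (s : R) (w b : nat -> R)
    (Hslices : spherical_slices w)
    (Hb : no_starting_translation b)
    (Himm : immersed_at_zero (kinematic_surface s w b))
    (Hscal : constant_scalar_curvature_at_zero (kinematic_surface s w b) 0) :
  [/\ w 1%N = 0, w 2%N = 0 & w 7%N = 0] /\
  [/\ \sum_(4 <= i < 8) b i * w (i - 1)%N = 0,
      \sum_(4 <= i < 8) b i * w (i + 4)%N = 0 &
      \sum_(4 <= i < 8) b i * w (i + 8)%N = 0] /\
  \sum_(3 <= i < 7) w i ^+ 2 = \sum_(4 <= i < 8) b i ^+ 2.
Proof.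
pose A := b 4%N ^+ 2 + (b 5%N ^+ 2 + (b 6%N ^+ 2 + b 7%N ^+ 2)) + speed2 s w.
have cos0_neq0 : cos (0 : R) != 0 by rewrite cos0 oner_neq0.
have scal_eq0 theta phi (c0 : cos phi != 0) :=
  etrans (esym (scalar_curvature_jet Hslices Hb c0
    (immersion_metric_unitmx (Himm theta phi c0)))) (Hscal theta phi c0).
have lapse_neq0 theta phi (c0 : cos phi != 0) :=
  lapse2_neq0 Hslices Hb c0 (immersion_metric_unitmx (Himm theta phi c0)).
(* Restrict to the equator phi = 0. *)
have [w20 w70 d00 d10] : [/\ w 2%N = 0, w 7%N = 0, drift0 w b = 0 & drift1 w b = 0].
  apply: (equator_rigidity (A := A) (s := s) (L := speed2 s w) (w1 := w 1%N) (r := drift2 w b)).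
  move=> n0 n1 /circle_angle[theta [<- <-]] p q u v Q.
  have QE : Q = lapse2 s w b theta 0.
    by rewrite /lapse2 cos0 sin0 /Q /A /p /u; ring.
  apply: quadratic_of_inverse; first by rewrite QE; exact: lapse_neq0.
  have := scal_eq0 theta 0 cos0_neq0.
  by rewrite cos0 sin0 equator_jet_curvature -QE.
(* By axial symmetry the meridian theta = 0 carries all remaining information. *)
have jetP phi (c0 : cos phi != 0) :
    let Q := A + 2 * drift2 w b * sin phi - w 1%N ^+ 2 * cos phi ^+ 2 in
    Q != 0 /\ 2 * Q ^+ 2 + (2 * s ^+ 2 - 4 * speed2 s w - 2 * w 1%N ^+ 2 * cos phi ^+ 2
      + 4 * w 1%N ^+ 2 * sin phi ^+ 2) * Q
    + (2 * drift2 w b ^+ 2 + 4 * drift2 w b * w 1%N ^+ 2 * sin phi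
       + 2 * w 1%N ^+ 4 * sin phi ^+ 2 + 4 * w 1%N ^+ 2 * s ^+ 2) * cos phi ^+ 2 = 0.
  move=> Q; have QE : Q = lapse2 s w b 0 phi.
    by rewrite /lapse2 w20 w70 d00 d10 /Q /A; ring.
  have Q0 : Q != 0 by rewrite QE; exact: lapse_neq0.
  split=> //; apply: quadratic_of_inverse => //.
  have := scal_eq0 0 phi c0.
  by rewrite -QE w20 w70 d00 d10 !mul0r !addr0 subr0 axial_jet_curvature.
have [w10 d20] : w 1%N = 0 /\ drift2 w b = 0.
  apply: (axial_rigidity (A := A) (s := s) (L := speed2 s w)) => c z c0 /circle_angle.
  by move=> [phi [cE zE]]; move: c0; rewrite -cE -zE => /jetP[].
have [] := jetP 0 cos0_neq0; rewrite w10 d20 cos0 sin0 /= => A0 E.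
(* At this point Q = [A]. Cancelling it gives |b|^2 = L - s^2, which is the sum of w_3^2, ..., w_6^2
   because w_1 = w_2 = 0. *)
have : A = 2 * speed2 s w - s ^+ 2.
  by apply: (mulfI A0); move: A0 => _; lra.
rewrite /A /speed2 w10 w20 => AE.
move: d00 d10 d20; rewrite /drift0 /drift1 /drift2 => d00 d10 d20.
split; first by split.
rewrite unlock /= !addr0; split; last by lra.
(* The three sums are the negated components of beta. *)
by split; apply: oppr_inj; rewrite oppr0.
Qed.
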